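(* Consider the sequence of iterations generated (without any stopping criterion) by the Main algorithm described in the context, and let $a_k=\sum_{i=1}^{\mu}\omega_k^i\tilde d_k^i$ (directions indexed according to the reordered offspring, so that $x_{k+1}^{\mathrm{trial}}=x_k+\sigma_ka_k$). Assume that $f$ is bounded below. Suppose that Restoration is not entered after a certain order. Let $x_*\in\Omega_{nr}$ be the limit point of a convergent subsequence of unsuccessful iterates $\{x_k\}_K$ for which $\lim_{k\in K}\sigma_k=0$. Assume that $g$ is Lipschitz continuous near $x_*$ with constant $\nu_g>0$. If $d\in T^{H}_{\Omega_{nr}}(x_* )$ is a refining direction associated with $\{a_k/\|a_k\|\}_K$, then either $g(x_* )=0$ or $g^\circ(x_*;d)\ge0$.
   Context: Problem: minimize $f(x)$ subject to $x\in\Omega=\Omega_{r}\cap\Omega_{nr}\subset\mathbb{R}^n$, where $f$ is locally Lipschitz continuous, $\Omega_{r}=\{x\in\mathbb{R}^n: c_i(x)\le 0,\ i=1,\dots,r\}$ with $c_i$ locally Lipschitz continuous (relaxable constraints), and $\Omega_{nr}\subset\mathbb{R}^n$ (unrelaxable constraints). The function $g\ge 0$ is a constraint violation function with respect to the relaxable constraints, with $g(x)=0$ if and only if $x\in\Omega_{r}$ (for instance $g(x)=\sum_{i=1}^r\max(c_i(x),0)$ or $g(x)=\sum_{i=1}^r\max(c_i(x),0)^2$). For a fixed $\bar\delta>0$ the merit function is $M(x)=f(x)+\bar\delta g(x)$ if $x\in\Omega_{nr}$ and $M(x)=+\infty$ otherwise; $g_{\Omega_{nr}}(x)=g(x)$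 if $x\in\Omega_{nr}$ and $+\infty$ otherwise. Data: positive integers $\lambda\ge\mu$; $x_0\in\Omega_{nr}$; $\sigma_0>0$; constants $0<\beta_1\le\beta_2<1$, $0<d_{\min}<d_{\max}$, $C>1$; a forcing function $\rho$, i.e. a positive, nondecreasing function with $\rho(\sigma)/\sigma\to0$ as $\sigma\to0$; $S=\{\omega\in\mathbb{R}^\mu:\sum_{i=1}^\mu\omega^i=1,\ \omega^i\ge0\}$. Main algorithm, iteration $k$, given $x_k\in\Omega_{nr}$, $\sigma_k>0$, weights $(\omega_k^1,\dots,\omega_k^\mu)\in S$: (1) Form offspring $y_{k+1}^i=x_k+\sigma_k\tilde d_k^i$, $i=1,\dots,\lambda$, where the directions $\tilde d_k^i$ are computed from original evolution strategy (ES) directions $d_k^i$, which are drawn from a chosen distribution $\mathcal{C}_k$ and scaled if necessary to satisfy $d_{\min}\le\|d_k^i\|\le d_{\max}$ (the $\tilde d_k^i$ may for instance take into account the local geometry of $\Omega_{nr}$). (2) Reorder the offspring as $\tilde y_{k+1}^1,\dots,\tilde y_{k+1}^\lambda$ with nondecreasing values of $M$ (the directions being re-indexed accordingly) and set $x_{k+1}^{\mathrm{trial}}=\sum_{i=1}^\mu\omega_k^i\tilde y_{k+1}^i$. (3) If $x_{k+1}^{\mathrm{trial}}\notin\Omega_{nr}$, the iteration is unsuccessful. Otherwise, if $x_{k+1}^{\mathrm{trial}}$ is a restoration identifier, i.e. $g_{\Omega_{nr}}(x_{k+1}^{\mathrm{trial}})<g(x_k)-\rho(\sigma_k)$, $g(x_k)>C\rho(\sigma_k)$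 and $M(x_{k+1}^{\mathrm{trial}})\ge M(x_k)$, enter Restoration with $k_r=k$. Otherwise, if $x_{k+1}^{\mathrm{trial}}$ is a successful point, i.e. either [$g_{\Omega_{nr}}(x_{k+1}^{\mathrm{trial}})<g(x_k)-\rho(\sigma_k)$ and $g(x_k)>C\rho(\sigma_k)$] or $M(x_{k+1}^{\mathrm{trial}})<M(x_k)-\rho(\sigma_k)$, the iteration is successful: $x_{k+1}=x_{k+1}^{\mathrm{trial}}$ and $\sigma_{k+1}\ge\sigma_k$. Otherwise it is unsuccessful. If unsuccessful: $x_{k+1}=x_k$, $\sigma_{k+1}=\beta_k\sigma_k$ with $\beta_k\in[\beta_1,\beta_2]$. (4) Update the distribution $\mathcal{C}_{k+1}$ and the weights in $S$ (the update is left unspecified). Restoration, iterations $k=k_r,k_r+1,\dots$, started from $x_{k_r}\in\Omega_{nr}$: same as Main except that the offspring are ordered by nondecreasing $g_{\Omega_{nr}}$, and step (3) is: the iteration is successful ($x_{k+1}=x_{k+1}^{\mathrm{trial}}$, $\sigma_{k+1}\ge\sigma_k$) if $x_{k+1}^{\mathrm{trial}}\in\Omega_{nr}$, $g(x_{k+1}^{\mathrm{trial}})<g(x_k)-\rho(\sigma_k)$ and $g(x_k)>C\rho(\sigma_k)$; otherwise it is unsuccessful, and then if $M(x_{k+1}^{\mathrm{trial}})<M(x_k)$ one leaves Restoration and returns to Main at a new iteration $k+1$ using $x_{k+1}$ and $\sigma_{k+1}$ (their values in this branch are not specified further), and if not, $x_{k+1}=x_k$, $\sigma_{k+1}=\beta_k\sigma_k$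 with $\beta_k\in[\beta_1,\beta_2]$. ''Restoration is not entered after a certain order'' means that there is an index $\hat k$ such that all iterations $k\ge\hat k$ are carried out in the Main algorithm. An unsuccessful iterate is an $x_k$ whose iteration $k$ is unsuccessful. A vector $d\in\mathbb{R}^n$ is hypertangent to $\Omega_{nr}$ at $x\in\Omega_{nr}$ if there is $\epsilon>0$ such that $y+tw\in\Omega_{nr}$ for all $y\in\Omega_{nr}\cap B(x;\epsilon)$, $w\in B(d;\epsilon)$, $0<t<\epsilon$ ($B$ denotes closed balls); $T^{H}_{\Omega_{nr}}(x)$ is the set of all such $d$. For $h$ Lipschitz continuous near $x_*\in\Omega_{nr}$ and $d\in T^{H}_{\Omega_{nr}}(x_* )$, the Clarke-Jahn generalized derivative is $$h^\circ(x_*;d)=\limsup_{x\to x_*,\,x\in\Omega_{nr},\,t\downarrow0,\,x+td\in\Omega_{nr}}\frac{h(x+td)-h(x)}{t}.$$ A refining direction associated with $\{a_k/\|a_k\|\}_K$, for a subsequence $K$ of unsuccessful iterates with $x_k\to x_*$ and $\sigma_k\to0$ on $K$, is a limit point of $\{a_k/\|a_k\|\}$ for all $k\in K$ sufficiently large such that $x_k+\sigma_ka_k\in\Omega_{nr}$.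
   Formalization: Two assumptions are added, without which the claim fails: along K, $\sigma_k\|a_k\|\to0$ and $\rho(\sigma_k)/(\sigma_k\|a_k\|)\to0$ (both hold, for instance, if $\|a_k\|$ is bounded and bounded away from zero along K). *)

(* Defs.v *)
From HB Require Import structures.
From mathcomp Require Import all_boot all_order all_algebra perm.
From mathcomp Require Import all_classical all_reals all_analysis.

Set Implicit Arguments.
Unset Strict Implicit.
Unset Printing Implicit Defensive.

Import Order.TTheory GRing.Theory Num.Theory.
Import numFieldNormedType.Exports.

Local Open Scope classical_set_scope.
Local Open Scope ring_scope.

(* The library norm on 'rV[R]_n is the max norm, hence this definition. Both
   norms induce the same topology, so limits are those of the library. *)
Definition enorm (R : realType) (n : nat) (v : 'rV[R]_n) : R :=
  Num.sqrt (\sum_i v 0 i ^+ 2).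

Definition ecball (R : realType) (n : nat) (x : 'rV[R]_n) (e : R) :
  set 'rV[R]_n := [set y | enorm (y - x) <= e].

Definition lipschitz_near (R : realType) (n : nat) (nu : R)
    (h : 'rV[R]_n -> R) (x : 'rV[R]_n) : Prop :=
  exists2 e : R, 0 < e & forall y z, ecball x e y -> ecball x e z ->
    `|h y - h z| <= nu * enorm (y - z).

Definition locally_lipschitz (R : realType) (n : nat)
    (h : 'rV[R]_n -> R) : Prop :=
  forall x, exists2 nu : R, 0 < nu & lipschitz_near nu h x.

Definition hypertangent (R : realType) (n : nat) (D : set 'rV[R]_n)
    (x : 'rV[R]_n) : set 'rV[R]_n :=
  [set d | exists2 e : R, 0 < e & forall y w t,
    (D `&` ecball x e) y -> ecball d e w -> 0 < t < e -> D (y + t *: w)].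

(* The upper limit is taken over pairs (x, t) tending to (xs, 0) within the
   admissible pairs; x = xs is allowed, t = 0 is not. *)
Definition clarke_jahn (R : realType) (n : nat) (D : set 'rV[R]_n)
    (h : 'rV[R]_n -> R) (xs d : 'rV[R]_n) : \bar R :=
  limf_esup (fun p : 'rV[R]_n * R => ((h (p.1 + p.2 *: d) - h p.1) / p.2)%:E)
    (within [set p | [/\ D p.1, 0 < p.2 & D (p.1 + p.2 *: d)]]
       (nbhs (xs, 0 : R))).

Definition forcing (R : realType) (rho : R -> R) : Prop :=
  [/\ forall s, 0 < s -> 0 < rho s,
      forall s t, 0 < s -> s <= t -> rho s <= rho t &
      rho s / s @[s --> 0^'+] --> (0 : R)].

Record problem (R : realType) (n : nat) := Problem {
  obj : 'rV[R]_n -> R;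
  ncon : nat;
  con : 'I_ncon -> 'rV[R]_n -> R;
  unrelax : set 'rV[R]_n;
  viol : 'rV[R]_n -> R;
  obj_lipschitz : locally_lipschitz obj;
  con_lipschitz : forall i, locally_lipschitz (con i);
  viol_ge0 : forall x, 0 <= viol x;
  viol_eq0 : forall x, viol x = 0 <-> (forall i, con i x <= 0)
}.

Record params (R : realType) := Params {
  delta : R;
  lambda : nat;
  mu : nat;
  beta1 : R;
  beta2 : R;
  dmin : R;
  dmax : R;
  Crest : R;
  rho : R -> R;
  delta_gt0 : 0 < delta;
  mu_gt0 : (0 < mu)%N;
  mu_le_lambda : (mu <= lambda)%N;
  beta1_gt0 : 0 < beta1;
  beta1_le_beta2 : beta1 <= beta2;
  beta2_lt1 : beta2 < 1;
  dmin_gt0 : 0 < dmin;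
  dmin_lt_dmax : dmin < dmax;
  Crest_gt1 : 1 < Crest;
  rho_forcing : forcing rho
}.

Definition merit (R : realType) (n : nat) (P : problem R n) (A : params R)
    (x : 'rV[R]_n) : \bar R :=
  if x \in unrelax P then (obj P x + delta A * viol P x)%:E else +oo%E.

Definition viol_nr (R : realType) (n : nat) (P : problem R n)
    (x : 'rV[R]_n) : \bar R :=
  if x \in unrelax P then (viol P x)%:E else +oo%E.

(* One generation of offspring. The directions tdir actually used are computed
   from the ES directions by an unspecified rule, hence unconstrained; rank i
   is the original index of the i-th best offspring. *)
Record generation (R : realType) (n : nat) (A : params R) := Generation {
  esdir : 'I_(lambda A) -> 'rV[R]_n;
  tdir : 'I_(lambda A) -> 'rV[R]_n;
  rank : {perm 'I_(lambda A)}
}.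

Definition offspring (R : realType) (n : nat) (A : params R)
    (x : 'rV[R]_n) (s : R) (G : generation n A) (i : 'I_(lambda A)) :=
  x + s *: tdir G (rank G i).

Definition admissible (R : realType) (n : nat) (A : params R)
    (F : 'rV[R]_n -> \bar R) (x : 'rV[R]_n) (s : R) (G : generation n A) :=
  (forall i, dmin A <= enorm (esdir G i) <= dmax A) /\
  (forall i j : 'I_(lambda A), (i <= j)%N ->
     (F (offspring x s G i) <= F (offspring x s G j))%E).

Definition simplex (R : realType) (m : nat) : set ('I_m -> R) :=
  [set w | (forall i, 0 <= w i) /\ \sum_i w i = 1].

Inductive phase := Main | Restoration.

(* A realization of the algorithm. The phase is the one in which iteration k
   starts. An iteration which starts in Main and meets a restoration identifier
   is taken up again by Restoration (k_r = k) with a new generation: this is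
   why there are two generations per index, of which maingen k is meaningful
   only if iteration k starts in Main, and restgen k only if iteration k is
   carried out in Restoration. *)
Record trajectory (R : realType) (n : nat) (A : params R) := Trajectory {
  iter_pt : nat -> 'rV[R]_n;
  step : nat -> R;
  weight : nat -> 'I_(mu A) -> R;
  start_phase : nat -> phase;
  maingen : nat -> generation n A;
  restgen : nat -> generation n A
}.

Section Algorithm.
Context (R : realType) (n : nat) (P : problem R n) (A : params R).
Context (T : trajectory n A).

Local Notation x := (iter_pt T).
Local Notation sigma := (step T).
Local Notation M := (merit P A).
Local Notation g := (viol P).

Definition trial (k : nat) (G : generation n A) : 'rV[R]_n :=
  \sum_(i < mu A) weight T k i *:
    offspring (x k) (sigma k) G (widen_ord (mu_le_lambda A) i).

Definition mean_dir (k : nat) (G : generation n A) : 'rV[R]_n :=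
  \sum_(i < mu A) weight T k i *:
    tdir G (rank G (widen_ord (mu_le_lambda A) i)).

Definition restores (k : nat) (y : 'rV[R]_n) : Prop :=
  (viol_nr P y < (g (x k) - rho A (sigma k))%:E)%E /\
  Crest A * rho A (sigma k) < g (x k).

Definition restoration_identifier (k : nat) (y : 'rV[R]_n) : Prop :=
  restores k y /\ (M (x k) <= M y)%E.

Definition successful_point (k : nat) (y : 'rV[R]_n) : Prop :=
  restores k y \/ (M y < M (x k) - (rho A (sigma k))%:E)%E.

Definition restoration_entry (k : nat) : Prop :=
  [/\ start_phase T k = Main, unrelax P (trial k (maingen T k)) &
      restoration_identifier k (trial k (maingen T k))].

Definition in_restoration (k : nat) : Prop :=
  start_phase T k = Restoration \/ restoration_entry k.

Definition gen (k : nat) : generation n A :=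
  if `[< in_restoration k >] then restgen T k else maingen T k.

Definition xtrial (k : nat) : 'rV[R]_n := trial k (gen k).

Definition a_ (k : nat) : 'rV[R]_n := mean_dir k (gen k).

Definition successful (k : nat) : Prop :=
  unrelax P (xtrial k) /\
  (if `[< in_restoration k >] then restores k (xtrial k)
   else successful_point k (xtrial k)).

Definition unsuccessful (k : nat) : Prop := ~ successful k.

Definition leaves_restoration (k : nat) : Prop :=
  [/\ in_restoration k, unsuccessful k & (M (xtrial k) < M (x k))%E].

Definition accept (k : nat) : Prop :=
  x k.+1 = xtrial k /\ sigma k <= sigma k.+1.

Definition reject (k : nat) : Prop :=
  x k.+1 = x k /\
  exists2 b : R, beta1 A <= b <= beta2 A & sigma k.+1 = b * sigma k.

(* When Restoration is left, x_{k+1} and sigma_{k+1} are only known to be legal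
   input data of the next iteration. *)
Definition generated : Prop :=
  [/\ [/\ unrelax P (x 0%N), 0 < sigma 0%N & start_phase T 0%N = Main],
      forall k, simplex (weight T k),
      forall k, start_phase T k = Main ->
        admissible M (x k) (sigma k) (maingen T k),
      forall k, in_restoration k ->
        admissible (viol_nr P) (x k) (sigma k) (restgen T k) &
      forall k,
        [/\ successful k -> accept k,
            unsuccessful k -> ~ leaves_restoration k -> reject k,
            leaves_restoration k -> unrelax P (x k.+1) /\ 0 < sigma k.+1 &
            start_phase T k.+1 = Restoration <->
              in_restoration k /\ ~ leaves_restoration k]].

Definition restoration_not_entered_eventually : Prop :=
  exists khat, forall k, (khat <= k)%N -> ~ in_restoration k.

(* Limit points are taken along the k in K with an admissible trial point;
   a_k != 0 makes a_k / ||a_k|| meaningful. *)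
Definition refining_direction (K : set nat) : set 'rV[R]_n :=
  cluster ((enorm (a_ k))^-1 *: a_ k
    @[k --> within (K `&` [set k | unrelax P (x k + sigma k *: a_ k) /\
                                   a_ k != 0]) \oo]).

End Algorithm.

(* Main.v *)
Require Import Defs.
From HB Require Import structures.
From mathcomp Require Import all_boot all_order all_algebra perm.
From mathcomp Require Import all_classical all_reals all_analysis.
From mathcomp Require Import lra.

Import Order.TTheory GRing.Theory Num.Theory.
Import numFieldNormedType.Exports.

Local Open Scope classical_set_scope.
Local Open Scope ring_scope.

(** Write [xs] for the limit point and suppose [g xs > 0]. Along the indices [k]
used to define the refining direction, put [t_k = sigma_k * ||a_k||] and
[u_k = a_k / ||a_k||], so that the trial point is [x_k + t_k u_k] and lies in
[Omega_nr].

Since [rho (sigma_k) = (rho (sigma_k) / t_k) * t_k] tends to [0] while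
[g (x_k)] tends to [g xs > 0], eventually [g (x_k) > C rho (sigma_k)]. An
unsuccessful iteration with a trial point in [Omega_nr] can then only have
failed the decrease test, whichever phase it belongs to:
[g (x_k + t_k u_k) >= g (x_k) - rho (sigma_k)] ([unsuccessful_viol_ge]).

Dividing by [t_k], the difference quotients of [g] at [x_k] along [u_k] are
bounded below by a null sequence. As [g] is Lipschitz near [xs], replacing
[u_k] by its limit point [d] costs at most a multiple of [||d - u_k||], and as
[d] is hypertangent, the points [x_k + t_k d] are admissible in the upper limit
defining [g^o (xs; d)] ([clarke_jahn_ge0]). *)

(** * Euclidean and maximum norm *)

Lemma enorm0 (R : realType) (n : nat) : enorm (0 : 'rV[R]_n) = 0.
Proof. by rewrite /enorm big1 ?sqrtr0 // => i _; rewrite mxE expr0n. Qed.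

Lemma enorm_gt0 (R : realType) (n : nat) (v : 'rV[R]_n) :
  v != 0 -> 0 < enorm v.
Proof.
move=> /eqP v0; rewrite sqrtr_gt0 lt_neqAle sumr_ge0 ?andbT; last first.
  by move=> i _; exact: sqr_ge0.
apply/eqP => /esym/eqP; rewrite psumr_eq0; last by move=> i _; exact: sqr_ge0.
move=> /allP v2; apply: v0; apply/rowP => i; rewrite mxE; apply/eqP.
by have := v2 i (mem_index_enum i); rewrite sqrf_eq0.
Qed.

Lemma enorm_le_norm (R : realType) (n : nat) (v : 'rV[R]_n) :
  enorm v <= Num.sqrt n%:R * `|v|.
Proof.
have -> : Num.sqrt n%:R * `|v| = Num.sqrt (\sum_(i < n) `|v| ^+ 2).
  rewrite sumr_const card_ord -[`|v| ^+ 2 *+ n]mulr_natl sqrtrM ?ler0n//.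
  by rewrite sqrtr_sqr normr_id.
apply: ler_wsqrtr; apply: ler_sum => i _; rewrite -real_normK ?num_real//.
rewrite ler_pXn2r ?nnegrE//.
rewrite [leRHS]/Num.Def.normr/= mx_normrE; apply/bigmax_geP; right => /=.
by exists (0, i).
Qed.

(** Limits are those of the maximum norm, while Lipschitz and hypertangent
neighbourhoods are Euclidean balls: this is how the former enter the latter. *)
Lemma norm_ball_ecball (R : realType) (n : nat) (x : 'rV[R]_n) (e : R) :
  0 < e -> exists2 r : R, 0 < r & forall y, `|x - y| <= r -> ecball x e y.
Proof.
move=> e0; set c := Num.sqrt (n%:R : R).
have c0 : 0 <= c by exact: sqrtr_ge0.
have c1 : 0 < c + 1 by lra.
exists (e / (c + 1)); first by rewrite divr_gt0.
move=> y; rewrite distrC ler_pdivlMr// => xy; rewrite /ecball/=.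
have := enorm_le_norm _ _ (y - x); rewrite -/c.
have := normr_ge0 (y - x); nra.
Qed.

Lemma nbhs_norm_le (R : realType) (n : nat) (x : 'rV[R]_n) (r : R) :
  0 < r -> nbhs x [set y | `|x - y| <= r].
Proof.
by move=> r0; near=> y; near: y; apply: cvgr_dist_le.
Unshelve. all: by end_near.
Qed.

Lemma lipschitz_near_cvg (R : realType) (n : nat) (nu : R)
    (h : 'rV[R]_n -> R) (xs : 'rV[R]_n) (I : Type) (F : set_system I)
    {FF : Filter F} (x : I -> 'rV[R]_n) :
  0 < nu -> lipschitz_near nu h xs ->
  x k @[k --> F] --> xs -> h (x k) @[k --> F] --> h xs.
Proof.
move=> nu0 [e e0 hlip] xcv; apply/cvgrPdist_le => eps eps0.
have [b b0 bE] := norm_ball_ecball _ _ xs _ e0.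
have [b' b'0 bE'] := norm_ball_ecball _ _ xs _ (divr_gt0 eps0 nu0).
near=> k.
have kb : `|xs - x k| <= b by near: k; exact: cvgr_dist_le.
have kb' : `|xs - x k| <= b' by near: k; exact: cvgr_dist_le.
have xx : ecball xs e xs by rewrite /ecball/= subrr enorm0 ltW.
rewrite distrC; apply: le_trans (hlip _ _ (bE _ kb) xx) _.
by rewrite mulrC -ler_pdivlMr//; exact: (bE' _ kb').
Unshelve. all: by end_near.
Qed.

(** * Lower bound for the Clarke-Jahn derivative *)

(** The pairs [(x k, t k)] witness the upper limit: they are admissible for the
direction [d] because [d] is hypertangent, and passing from [u k] to [d] changes
the difference quotient by at most [nu * enorm (d - u k)], which is small for
suitable [k] arbitrarily far along [F] since [d] clusters [u]. *)
Lemma clarke_jahn_ge0 (R : realType) (n : nat) (D : set 'rV[R]_n)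
    (h : 'rV[R]_n -> R) (nu : R) (xs d : 'rV[R]_n) (I : Type)
    (F : set_system I) {FF : Filter F} (x u : I -> 'rV[R]_n) (t r : I -> R) :
  0 < nu -> lipschitz_near nu h xs -> hypertangent D xs d ->
  x k @[k --> F] --> xs -> t k @[k --> F] --> (0 : R) ->
  r k @[k --> F] --> (0 : R) -> cluster (u k @[k --> F]) d ->
  (\forall k \near F,
     [/\ D (x k), 0 < t k & h (x k) - r k * t k <= h (x k + t k *: u k)]) ->
  (0 <= clarke_jahn D h xs d)%E.
Proof.
move=> nu0 [e e0 hlip] [e' e'0 htan] xcv tcv rcv dclu good.
have [b b0 bE] := norm_ball_ecball _ _ xs _ e0.
have [b' b'0 bE'] := norm_ball_ecball _ _ xs _ e'0.
rewrite /clarke_jahn; apply/ereal_infP => _ [V VF <-].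
apply/lee_addgt0Pr => eps eps0; rewrite -leeBlDr// sub0e.
apply: le_ereal_sup_tmp.
have xt : (x k, t k) @[k --> F] --> (xs, 0 : R)
  by exact: cvg_pair xcv tcv.
set c := Num.sqrt (n%:R : R).
have c0 : 0 <= c by exact: sqrtr_ge0.
have nc0 : 0 < nu * c + 1 by nra.
(* half of eps pays for r k, the other half for replacing u k by d *)
set eta := Num.min 1 (eps / 2 / (nu * c + 1)).
have eta0 : 0 < eta by rewrite lt_min ltr01/= !divr_gt0.
have d1 : 0 < `|d| + 1 by rewrite ltr_wpDl.
(* the bounds b / 2 on x k and on t k * (|d| + 1) keep both x k + t k *: u k and
   x k + t k *: d in the ball where h is Lipschitz *)
pose E := [set k | [/\ 0 < t k, D (x k),
  h (x k) - r k * t k <= h (x k + t k *: u k) &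
  [/\ ([set p | [/\ D p.1, 0 < p.2 & D (p.1 + p.2 *: d)]] (x k, t k) ->
         V (x k, t k)), [/\ `|xs - x k| <= b', `|xs - x k| <= b / 2 & t k < e'],
      t k <= b / 2 / (`|d| + 1) & r k <= eps / 2]]].
have FV : \forall k \near F,
    [set p | [/\ D p.1, 0 < p.2 & D (p.1 + p.2 *: d)]] (x k, t k) ->
    V (x k, t k) by exact: (xt _ VF).
have FE : (u k @[k --> F]) (u @` E).
  rewrite /fmap/=; near=> k; exists k => //.
  have [Dk tk hk] : [/\ D (x k), 0 < t k &
      h (x k) - r k * t k <= h (x k + t k *: u k)] by near: k.
  split=> //; split.
  + by near: k; exact: FV.
  + split; near: k; [exact: cvgr_dist_le| |exact: (cvgr_lt 0)].
    by apply: cvgr_dist_le => //; rewrite divr_gt0.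
  + by near: k; apply: (cvgr_le 0) => //; rewrite !divr_gt0.
  + by near: k; apply: (cvgr_le 0) => //; rewrite divr_gt0.
have nd : nbhs d [set v | `|d - v| <= eta] by exact: nbhs_norm_le.
have [_ [[k [tk Dk hk [Vk [xkb' xkb tke'] tkb rk]] <-] uk]] := dclu _ _ FE nd.
have uk1 : `|d - u k| <= 1 by rewrite (le_trans uk)// /eta ge_min lexx.
have uk2 : `|d - u k| * (nu * c + 1) <= eps / 2.
  by rewrite -ler_pdivlMr// (le_trans uk)// /eta ge_min lexx orbT.
have Dd : D (x k + t k *: d).
  apply: htan; [by split => //; exact: bE'| |by rewrite tk].
  by rewrite /ecball/= subrr enorm0 ltW.
exists (((h (x k + t k *: d) - h (x k)) / t k)%:E).
  by exists (x k, t k) => //; exact: Vk.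
rewrite lee_fin ler_pdivlMr//.
have inE (w : 'rV[R]_n) : `|w| <= `|d| + 1 -> ecball xs e (x k + t k *: w).
  move=> wd; apply: bE; rewrite opprD addrA.
  apply: le_trans (ler_normB _ _) _; rewrite normrZ gtr0_norm//.
  have := tkb; rewrite ler_pdivlMr// => tkd.
  have : t k * `|w| <= t k * (`|d| + 1) by rewrite ler_pM2l.
  lra.
have ukd : `|u k| <= `|d| + 1.
  have -> : u k = d - (d - u k) by rewrite subKr.
  by apply: le_trans (ler_normB _ _) _; rewrite lerD2l.
have := hlip _ _ (inE _ ukd) (inE d (ler_wpDr ler01 (lexx _))).
rewrite opprD addrACA subrr add0r -scalerBr => hl.
have en : enorm (t k *: (u k - d)) <= c * (t k * `|d - u k|).
  by apply: le_trans (enorm_le_norm _ _ _) _; rewrite normrZ gtr0_norm// distrC.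
have := le_trans (ler_norm _) hl => hl1.
have en1 : nu * enorm (t k *: (u k - d)) <= nu * (c * (t k * `|d - u k|)).
  by rewrite ler_pM2l.
have du : t k * (`|d - u k| * (nu * c + 1)) <= t k * (eps / 2).
  by rewrite ler_pM2l.
have rt : r k * t k <= eps / 2 * t k by rewrite ler_pM2r.
have tdu : 0 <= t k * `|d - u k| by rewrite mulr_ge0// ltW.
lra.
Unshelve. all: by end_near.
Qed.

(** * Iterates of the algorithm *)

Section Iterates.
Context (R : realType) (n : nat) (P : problem R n) (A : params R).
Context (T : trajectory n A) (genT : generated P T).

Lemma iter_unrelax k : unrelax P (iter_pt T k).
Proof.
case: genT => -[x0 _ _] _ _ _ gen_step; elim: k => [//|k xk].
have [succ unsucc leave _] := gen_step k.
have [s|ns] := pselect (successful P T k).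
  by have [-> _] := succ s; case: s.
have [l|nl] := pselect (leaves_restoration P T k).
  by have [] := leave l.
by have [-> _] := unsucc ns nl.
Qed.

Lemma step_gt0 k : 0 < step T k.
Proof.
case: genT => -[_ s0 _] _ _ _ gen_step; elim: k => [//|k sk].
have [succ unsucc leave _] := gen_step k.
have [s|ns] := pselect (successful P T k).
  by have [_] := succ s; exact: lt_le_trans.
have [l|nl] := pselect (leaves_restoration P T k).
  by have [] := leave l.
have [_ [b /andP[b1 _] ->]] := unsucc ns nl.
by rewrite mulr_gt0// (lt_le_trans (beta1_gt0 A)).
Qed.

Lemma xtrialE k : xtrial P T k = iter_pt T k + step T k *: a_ P T k.
Proof.
case: genT => _ /(_ k)[_ w1] _ _ _.
rewrite /xtrial /a_ /trial /mean_dir /offspring.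
under eq_bigr do rewrite scalerDr scalerA mulrC -scalerA.
by rewrite big_split/= -scaler_suml w1 scale1r -scaler_sumr.
Qed.

(** The condition [restores] is part of the success criterion of both phases, so
its failure does not depend on the phase of iteration [k]. *)
Lemma unsuccessful_viol_ge k : unsuccessful P T k ->
  unrelax P (xtrial P T k) ->
  Crest A * rho A (step T k) < viol P (iter_pt T k) ->
  viol P (iter_pt T k) - rho A (step T k) <= viol P (xtrial P T k).
Proof.
move=> uns tr Cg; rewrite leNgt; apply/negP => dec; apply: uns; split=> //.
have res : restores P T k (xtrial P T k).
  by split=> //; rewrite /viol_nr mem_set.
by case: ifP => _ //; left.
Qed.

End Iterates.

(** * Limit points of unsuccessful iterates *)

(* step_length_cvg and forcing_ratio_cvg are not spelled out in the informal
   statement. They are the assumptions on the a_k which make the refining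
   direction argument work; the conclusion is false without them, e.g. when the
   weights let the selected directions cancel so that ||a_k|| = sigma_k / 2 with
   rho(sigma) = sigma^2. *)
Theorem theorem4p2 (R : realType) (n : nat) (P : problem R n) (A : params R)
  (T : trajectory n A) (T_generated : generated P T)
  (f_bounded_below : has_lbound (range (obj P)))
  (no_restoration : restoration_not_entered_eventually P T)
  (K : set nat) (K_infinite : infinite_set K)
  (K_unsuccessful : forall k, K k -> unsuccessful P T k)
  (xs : 'rV[R]_n) (xs_nr : unrelax P xs)
  (x_cvg : iter_pt T k @[k --> within K \oo] --> xs)
  (sigma_cvg : step T k @[k --> within K \oo] --> (0 : R))
  (step_length_cvg :
    step T k * enorm (a_ P T k) @[k --> within K \oo] --> (0 : R))
  (forcing_ratio_cvg :
    rho A (step T k) / (step T k * enorm (a_ P T k))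
      @[k --> within K \oo] --> (0 : R))
  (nu_g : R) (nu_g_gt0 : 0 < nu_g)
  (g_lipschitz : lipschitz_near nu_g (viol P) xs)
  (d : 'rV[R]_n) (d_hypertangent : hypertangent (unrelax P) xs d)
  (d_refining : refining_direction P T K d) :
  viol P xs = 0 \/ (0 <= clarke_jahn (unrelax P) (viol P) xs d)%E.
Proof.
have [g0|/eqP g0] := eqVneq (viol P xs) 0; [by left|right].
have {g0} gs : 0 < viol P xs.
  by rewrite lt_neqAle viol_ge0 eq_sym andbT; apply/eqP.
set S := [set k | unrelax P (iter_pt T k + step T k *: a_ P T k) /\
  a_ P T k != 0].
have sub : within (K `&` S) \oo --> within K \oo by exact: within_subset.
have tgt0 k : S k -> 0 < step T k * enorm (a_ P T k).
  by move=> [_ a0]; rewrite mulr_gt0 ?enorm_gt0//; exact: step_gt0 T_generated k.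
have xS := cvg_trans (cvg_app _ sub) x_cvg.
have tS := cvg_trans (cvg_app _ sub) step_length_cvg.
have rS := cvg_trans (cvg_app _ sub) forcing_ratio_cvg.
have inS : \forall k \near within (K `&` S) \oo, K k /\ S k.
  by rewrite near_withinE; near=> k.
have gS : viol P (iter_pt T k) @[k --> within (K `&` S) \oo] --> viol P xs.
  exact: lipschitz_near_cvg nu_g_gt0 g_lipschitz xS.
(* rho (sigma_k) is written as a ratio times the step length t_k: both factors
   are known to tend to 0, and t_k is nonzero on S *)
have rhoS : Crest A * (rho A (step T k) / (step T k * enorm (a_ P T k)) *
    (step T k * enorm (a_ P T k))) @[k --> within (K `&` S) \oo] --> (0 : R).
  rewrite -[X in _ --> X](mulr0 (Crest A)) -[X in _ * X](mulr0 0).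
  by apply: cvgMl_tmp; apply: cvgM.
have test : \forall k \near within (K `&` S) \oo,
    Crest A * (rho A (step T k) / (step T k * enorm (a_ P T k)) *
      (step T k * enorm (a_ P T k))) < viol P (iter_pt T k).
  have half0 : 0 < viol P xs / 2 by rewrite divr_gt0.
  have half_lt : viol P xs / 2 < viol P xs by lra.
  near=> k; apply: (@lt_trans _ _ (viol P xs / 2)); near: k.
    exact: cvgr_lt rhoS _ half0.
  exact: cvgr_gt gS _ half_lt.
apply: (clarke_jahn_ge0 _ _ _ _ _ _ _ _ _ _ _ _ _ nu_g_gt0 g_lipschitz
  d_hypertangent xS tS rS d_refining).
near=> k.
have [Kk Sk] : K k /\ S k by near: k.
have tk := tgt0 _ Sk; split=> //; first exact: iter_unrelax T_generated k.
have ak : enorm (a_ P T k) != 0 by rewrite gt_eqF// enorm_gt0//; case: Sk.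
rewrite divfK ?gt_eqF// scalerA mulfK// -xtrialE//.
apply: unsuccessful_viol_ge; first exact: K_unsuccessful.
  by rewrite xtrialE//; case: Sk.
rewrite -[rho A _](@divfK _ (step T k * enorm (a_ P T k))) ?gt_eqF//.
by near: k.
Unshelve. all: by end_near.
Qed.
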